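(* Let $\kappa:\mathbb{R}^n\to\mathbb{R}\cup\{+\infty\}$ and $\rho:\mathbb{R}^m\to\mathbb{R}\cup\{+\infty\}$ be closed gauges, $A:\mathbb{R}^n\to\mathbb{R}^m$ linear, $b\in\mathbb{R}^m$, $\sigma\ge0$, with $\rho(b)>\sigma$. Consider the gauge primal $(G_p)$ and gauge dual $(G_d)$ and the value functions $v_p$, $p=-1/v_p$ and $v_d$ defined in the context. (a) If the primal is relatively strictly feasible and the dual is feasible, then the set of optimal solutions of the dual is nonempty and coincides with $\partial p(0)=\partial(-1/v_p)(0)$. If moreover the primal is strictly feasible, then the set of optimal solutions of the dual is bounded. (b) If the dual is relatively strictly feasible and the primal is feasible, then the set of optimal solutions of the primal is nonempty, and these solutions are the points $x^*=w^*/\lambda^*$ where $(w^*,\lambda^* )\in\partial v_d(0,0)$ and $\lambda^*>0$. If moreover the dual is strictly feasible, then the set of optimal solutions of the primal is bounded.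
   Context: A gauge is a convex function into $\mathbb{R}\cup\{+\infty\}$ that is nonnegative, positively homogeneous, and vanishes at the origin; closed means lower semicontinuous. The polar of a gauge $\kappa$ is $\kappa^\circ(y)=\inf\{\mu>0\mid\langle x,y\rangle\le\mu\kappa(x)\ \forall x\}$ (with $\inf\emptyset=+\infty$). $\operatorname{dom}h=\{h<+\infty\}$, $\partial$ is the convex subdifferential, and $\delta_C$ is the $0/{+\infty}$ indicator of $C$. $\mathcal{H}_\rho=\{u\mid\rho(u)=0\}$. Problems: $(G_p)$: minimize $\kappa(x)$ subject to $\rho(b-Ax)\le\sigma$. $(G_d)$: minimize $\kappa^\circ(A^Ty)$ subject to $\langle b,y\rangle-\sigma\rho^\circ(y)\ge1$. Convention: when $\sigma=0$, $\sigma\rho^\circ$ means $\delta_{\operatorname{cl}\operatorname{dom}\rho^\circ}$. Feasible sets: $\mathcal{F}_p=\{u\mid\rho(b-u)\le\sigma\}$, $\mathcal{F}_d=\{y\mid\langle b,y\rangle-\sigma\rho^\circ(y)\ge1\}$. $(G_p)$ (resp. $(G_d)$) is feasible if $A^{-1}\mathcal{F}_p\cap\operatorname{dom}\kappa\ne\emptyset$ (resp. $A^T\mathcal{F}_d\cap\operatorname{dom}\kappa^\circ\neq\emptyset$); relatively strictly feasible if $A^{-1}(\operatorname{ri}\mathcal{F}_p)\cap\operatorname{ri}\operatorname{dom}\kappa\neq\emptyset$ (resp. $A^T(\operatorname{ri}\mathcal{F}_d)\cap\operatorname{ri}\operatorname{dom}\kappa^\circ\ne\emptyset$); strictly feasible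 if the same holds with $\operatorname{int}$ in place of $\operatorname{ri}$. Value functions: for $\sigma>0$ and $u\in\mathbb{R}^m$, $$v_p(u)=\inf_{\mu>0,\,x}\{\mu\mid\rho(b-Ax+\mu u)\le\sigma,\ \kappa(x)\le\mu\},$$ $$p(u)=\inf\{-\lambda\mid w\in\mathbb{R}^n,\ \lambda\ge0,\ \rho(\lambda b-Aw+u)\le\sigma\lambda,\ \kappa(w)\le1\};$$ if $\sigma=0$, both are defined by the same formulas after replacing $(\rho,\sigma)$ by $(\delta_{\mathcal{H}_\rho},1)$. One has $p(u)=-1/v_p(u)$ whenever $0<v_p(u)<\infty$ and $p(u)=-\infty$ iff $v_p(u)=0$; the expression $-1/v_p$ denotes the function $p$ (where $v_p(u)=+\infty$, its value is that of $p(u)$, i.e. $0$ or $+\infty$). Also, for $(t,\theta)\in\mathbb{R}^n\times\mathbb{R}$, $$v_d(t,\theta)=\inf_y\{\kappa^\circ(A^Ty+t)\mid\langle b,y\rangle-\sigma\rho^\circ(y)\ge1+\theta\},$$ where, when $\sigma=0$, $\sigma\rho^\circ$ again means $\delta_{\operatorname{cl}\operatorname{dom}\rho^\circ}$. *)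

(* Defs.v *)
From mathcomp Require Export all_boot all_order all_algebra.
From mathcomp Require Export all_classical all_reals all_analysis.
Export Order.TTheory GRing.Theory Num.Theory.
Export numFieldNormedType.Exports.

Set Implicit Arguments.
Unset Strict Implicit.
Unset Printing Implicit Defensive.

Local Open Scope classical_set_scope.
Local Open Scope ring_scope.

Section ConvexAnalysis.
Context {R : realType}.

Definition dotv {n : nat} (x y : 'cV[R]_n) : R := \sum_(i < n) x i 0 * y i 0.

Definition dotvr {n : nat} (p q : 'cV[R]_n * R) : R :=
  dotv p.1 q.1 + p.2 * q.2.

Definition dom {T : Type} (h : T -> \bar R) : set T :=
  [set x | (h x < +oo)%E].

Definition indicator {T : Type} (C : set T) (x : T) : \bar R :=
  if x \in C then 0%E else +oo%E.

Definition econvex {n : nat} (f : 'cV[R]_n -> \bar R) : Prop :=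
  forall (x y : 'cV[R]_n) (t : R), 0 < t < 1 ->
    (f (t *: x + (1 - t) *: y)%R <= t%:E * f x + (1 - t)%:E * f y)%E.

Record gauge {n : nat} (f : 'cV[R]_n -> \bar R) : Prop := Gauge {
  gauge_ge0 : forall x, (0 <= f x)%E;
  gauge_convex : econvex f;
  gauge_homogeneous : forall (t : R) x, 0 < t -> f (t *: x) = (t%:E * f x)%E;
  gauge0 : f 0 = 0%E }.

Definition closed_gauge {n : nat} (f : 'cV[R]_n -> \bar R) : Prop :=
  gauge f /\ lower_semicontinuous f.

Definition polar {n : nat} (k : 'cV[R]_n -> \bar R) (y : 'cV[R]_n) : \bar R :=
  ereal_inf [set mu%:E | mu in
    [set mu : R | 0 < mu /\ forall x, ((dotv x y)%:E <= mu%:E * k x)%E]].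

Definition zero_set {n : nat} (k : 'cV[R]_n -> \bar R) : set 'cV[R]_n :=
  [set u | k u = 0%E].

Definition affine_set {n : nat} (M : set 'cV[R]_n) : Prop :=
  forall (x y : 'cV[R]_n) (t : R), M x -> M y -> M (t *: x + (1 - t) *: y).

Definition affine_hull {n : nat} (C : set 'cV[R]_n) : set 'cV[R]_n :=
  smallest affine_set C.

Definition ri {n : nat} (C : set 'cV[R]_n) : set 'cV[R]_n :=
  [set x | C x /\ \forall y \near x, affine_hull C y -> C y].

Definition subdifferential {V : zmodType} (ip : V -> V -> R)
    (f : V -> \bar R) (x : V) : set V :=
  [set g | forall z, (f x + (ip g (z - x)%R)%:E <= f z)%E].

Definition argmin {T : Type} (f : T -> \bar R) (D : set T) : set T :=
  [set x | D x /\ forall z, D z -> (f x <= f z)%E].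

End ConvexAnalysis.

Section GaugeDuality.
Context {R : realType} {m n : nat}.
Implicit Types (kappa : 'cV[R]_n -> \bar R) (rho : 'cV[R]_m -> \bar R).
Implicit Types (A : 'M[R]_(m, n)) (b : 'cV[R]_m) (sigma : R).

Definition scaled_polar rho sigma (y : 'cV[R]_m) : \bar R :=
  if sigma == 0 then indicator (closure (dom (polar rho))) y
  else (sigma%:E * polar rho y)%E.

Definition primal_set rho b sigma : set 'cV[R]_m :=
  [set u | (rho (b - u)%R <= sigma%:E)%E].

Definition dual_level rho b sigma (theta : R) : set 'cV[R]_m :=
  [set y | ((1 + theta)%:E <= (dotv b y)%:E - scaled_polar rho sigma y)%E].

Definition dual_set rho b sigma : set 'cV[R]_m :=
  [set y | (1%:E <= (dotv b y)%:E - scaled_polar rho sigma y)%E].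

Definition primal_feasible kappa rho A b sigma : Prop :=
  mulmx A @^-1` primal_set rho b sigma `&` dom kappa !=set0.

Definition primal_rel_strictly_feasible kappa rho A b sigma : Prop :=
  mulmx A @^-1` ri (primal_set rho b sigma) `&` ri (dom kappa) !=set0.

Definition primal_strictly_feasible kappa rho A b sigma : Prop :=
  mulmx A @^-1` interior (primal_set rho b sigma)
    `&` interior (dom kappa) !=set0.

Definition dual_feasible kappa rho A b sigma : Prop :=
  mulmx A^T @` dual_set rho b sigma `&` dom (polar kappa) !=set0.

Definition dual_rel_strictly_feasible kappa rho A b sigma : Prop :=
  mulmx A^T @` ri (dual_set rho b sigma) `&` ri (dom (polar kappa)) !=set0.

Definition dual_strictly_feasible kappa rho A b sigma : Prop :=
  mulmx A^T @` interior (dual_set rho b sigma)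
    `&` interior (dom (polar kappa)) !=set0.

Definition primal_solutions kappa rho A b sigma : set 'cV[R]_n :=
  argmin kappa [set x | (rho (b - A *m x)%R <= sigma%:E)%E].

Definition dual_solutions kappa rho A b sigma : set 'cV[R]_m :=
  argmin (fun y => polar kappa (A^T *m y)) (dual_set rho b sigma).

(* When sigma = 0 the primal value functions use (indicator H_rho, 1) in place
   of (rho, sigma). *)
Definition vf_rho rho sigma : 'cV[R]_m -> \bar R :=
  if sigma == 0 then indicator (zero_set rho) else rho.

Definition vf_sigma sigma : R := if sigma == 0 then 1 else sigma.

Definition v_p kappa rho A b sigma (u : 'cV[R]_m) : \bar R :=
  ereal_inf [set mu%:E | mu in [set mu : R | 0 < mu /\
    exists x : 'cV[R]_n,
      (vf_rho rho sigma (b - A *m x + mu *: u)%R <= (vf_sigma sigma)%:E)%E /\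
      (kappa x <= mu%:E)%E]].

Definition p_value kappa rho A b sigma (u : 'cV[R]_m) : \bar R :=
  ereal_inf [set (- lambda)%:E | lambda in [set lambda : R | 0 <= lambda /\
    exists w : 'cV[R]_n,
      (vf_rho rho sigma (lambda *: b - A *m w + u)%R
         <= (vf_sigma sigma * lambda)%:E)%E /\
      (kappa w <= 1)%E]].

(* In [\bar R], 0^-1 = +oo, so the value is -oo where v_p vanishes. *)
Definition neg_inv_v_p kappa rho A b sigma (u : 'cV[R]_m) : \bar R :=
  if v_p kappa rho A b sigma u == +oo%E then p_value kappa rho A b sigma u
  else (- (v_p kappa rho A b sigma u)^-1)%E.

Definition v_d kappa rho A b sigma (z : 'cV[R]_n * R) : \bar R :=
  ereal_inf [set polar kappa (A^T *m y + z.1) | y in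
    dual_level rho b sigma z.2].

End GaugeDuality.

(* Main.v *)
Require Import Defs.
From mathcomp Require Import ring lra.

(** A convex relation [E] in [V x R] whose domain is reversible at [0] (a ray
    leaving [0] into the domain can also be followed backwards) has an affine
    minorant through its lower value at [0]: extend the cone it generates by one
    basis vector at a time, as in the Hahn-Banach theorem. Relative strict
    feasibility of one problem says that the domain of its value function is
    reversible at [0], so the value function has a subgradient there. Unfolding
    the subgradient inequality, which is homogeneous in the problem data, turns
    it into the constraints of the other problem together with an upper bound on
    its objective by the optimal value (through the bipolar theorem on the
    [v_d] side), and weak duality makes this bound an optimality certificate.
    The case [sigma = 0] is the general one for the gauge
    [indicator (zero_set rho)] at level [1]. *)

Set Implicit Arguments.
Unset Strict Implicit.
Unset Printing Implicit Defensive.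

Local Open Scope classical_set_scope.
Local Open Scope ring_scope.

(** * Affine minorants *)

Section ConvexMinorant.
Context {R : realType} {V : lmodType R}.

(** [K u r] reads as: r bounds a sublinear function at u from above. [rcone_rev] makes the domain,
    if nonempty, a linear subspace, so that a direction outside it can receive any slope. *)
Record reversible_cone (K : V -> R -> Prop) : Prop := ReversibleCone {
  rcone_add : forall u v r q, K u r -> K v q -> K (u + v) (r + q);
  rcone_scale : forall t u r, 0 < t -> K u r -> K (t *: u) (t * r);
  rcone_pos : forall r, K 0 r -> 0 <= r;
  rcone_rev : forall u r, K u r -> exists q, K (- u) q }.

(** Adding [K (- e) q] and [K e r] lands at 0, so every - q lies below every r and a supremum
    separates them. If e is outside the domain, so is - e, and both bounds are void. *)
Lemma reversible_cone_slope (K : V -> R -> Prop) (e : V) :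
  reversible_cone K ->
  exists g : R,
    (forall r, K e r -> g <= r) /\ (forall r, K (- e) r -> - r <= g).
Proof.
move=> [Kadd Kscale Kpos Krev].
have [[r0 Kr0]|noK] := pselect (exists r, K e r); last first.
  exists 0; split=> r Kr; first by case: noK; exists r.
  by have [q] := Krev _ _ Kr; rewrite opprK => Kq; case: noK; exists q.
have [q0 Kq0] := Krev _ _ Kr0.
have le_slope q r : K (- e) q -> K e r -> - q <= r.
  move=> Kq Kr; have := Kadd _ _ _ _ Kq Kr.
  by rewrite addNr => /Kpos; lra.
exists (sup [set - q | q in K (- e)]); split=> r Kr.
  apply: ge_sup; first by exists (- q0), q0.
  by move=> _ [q Kq <-]; exact: le_slope.
apply: ub_le_sup; last by exists r.
by exists r0 => _ [q Kq <-]; exact: le_slope.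
Qed.

(** The new relation is [K] plus the line spanned by (e, g). The two slope bounds are what keeps it
    nonnegative above 0. *)
Lemma reversible_cone_extend (K : V -> R -> Prop) (e : V) (g : R) :
  reversible_cone K ->
  (forall r, K e r -> g <= r) -> (forall r, K (- e) r -> - r <= g) ->
  reversible_cone (fun u r => exists s, K (u - s *: e) (r - s * g)).
Proof.
move=> [Kadd Kscale Kpos Krev] ub lb; split.
- move=> u v r q [s Ks] [t Kt]; exists (s + t).
  rewrite scalerDl opprD addrACA.
  by have := Kadd _ _ _ _ Ks Kt; congr (K _ _); ring.
- move=> t u r t0 [s Ks]; exists (t * s).
  have := Kscale _ _ _ t0 Ks; rewrite scalerBr scalerA.
  by congr (K _ _); ring.
- move=> r [s]; rewrite sub0r => Ks.
  (* Dividing by |s| turns [Ks] into a statement about e or - e, according to the sign of s. *)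
  have [s0|s0|s0] := ltgtP s 0.
  + have si : 0 < - s^-1 by rewrite oppr_gt0 invr_lt0.
    have := Kscale _ _ _ si Ks.
    rewrite scalerN scaleNr opprK scalerA mulVf ?lt_eqF// scale1r => /ub.
    rewrite (_ : _ * _ = - s^-1 * r + g); last by field; rewrite lt_eqF.
    by rewrite lerDr pmulr_rge0.
  + have si : 0 < s^-1 by rewrite invr_gt0.
    have := Kscale _ _ _ si Ks.
    rewrite scalerN scalerA mulVf ?gt_eqF// scale1r => /lb.
    rewrite (_ : _ * _ = s^-1 * r - g); last by field; rewrite gt_eqF.
    by rewrite opprB gerBl pmulr_rge0.
  + by move: Ks; rewrite s0 scale0r oppr0 mul0r subr0 => /Kpos.
- move=> u r [s /Krev[q Kq]]; exists (q - s * g), (- s).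
  move: Kq; rewrite opprB scaleNr opprK addrC.
  by congr (K _ _); ring.
Qed.

(** Induction on the list: g0 is the slope for the first vector, and the other slopes come from the
    cone enlarged by the line through (e i, g0). *)
Lemma reversible_cone_minorant (I : eqType) (s : seq I) (e : I -> V) :
  uniq s -> forall K, reversible_cone K ->
  exists g : I -> R, forall u r (c : I -> R), K u r ->
    u = \sum_(i <- s) c i *: e i -> \sum_(i <- s) c i * g i <= r.
Proof.
elim: s => [_ K Kc|i s IH /= /andP[is_ us] K Kc].
  exists (fun=> 0) => u r c Kur; rewrite !big_nil => u0.
  by move: Kur; rewrite u0; exact: rcone_pos.
have [g0 [ub lb]] := reversible_cone_slope (e i) Kc.
have [g Hg] := IH us _ (reversible_cone_extend Kc ub lb).
exists (fun j => if j == i then g0 else g j) => u r c Kur.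
rewrite !big_cons eqxx => uE.
have := Hg (u - c i *: e i) (r - c i * g0) c.
rewrite -lerBrDl; have -> : \sum_(j <- s) c j * (if j == i then g0 else g j) =
    \sum_(j <- s) c j * g j.
  apply: eq_big_seq => j js; case: eqP => // ji.
  by rewrite -ji js in is_.
apply; last by rewrite uE addrAC subrr add0r.
by exists (- c i); rewrite scaleNr opprK subrK mulNr opprK subrK.
Qed.

(* The cone generated by the epigraph [E] translated by [(0, - c)] meets
   [{0} x R] in nonnegative reals only. *)
Lemma convex_minorant (I : eqType) (s : seq I) (e : I -> V)
    (E : V -> R -> Prop) (c : R) :
  uniq s ->
  (forall u v a b t, 0 < t < 1 -> E u a -> E v b ->
    E (t *: u + (1 - t) *: v) (t * a + (1 - t) * b)) ->
  (forall a, E 0 a -> c <= a) ->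
  (forall u a, E u a -> exists t b, 0 < t /\ E (- (t *: u)) b) ->
  exists g : I -> R, forall u a (x : I -> R), E u a ->
    u = \sum_(i <- s) x i *: e i -> c + \sum_(i <- s) x i * g i <= a.
Proof.
move=> us Econv Ec Erev.
have Kc : reversible_cone
    (fun u r => exists t, 0 < t /\ E (t *: u) (c + t * r)).
  split.
  - move=> u v r q [t [t0 Et]] [t' [t'0 Et']].
    have tt0 : 0 < t + t' by exact: addr_gt0.
    have ttn0 : t + t' != 0 by rewrite gt_eqF.
    (* t u and t' v get the weights t' / (t + t') and t / (t + t'), so that both carry the factor t
       t' / (t + t'). *)
    exists (t * t' / (t + t')); split; first by rewrite divr_gt0// mulr_gt0.
    have /Econv/(_ Et Et') : 0 < t' / (t + t') < 1.
      by rewrite divr_gt0//= ltr_pdivrMr// mul1r ltrDr.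
    rewrite !scalerA scalerDr; congr (E (_ *: _ + _ *: _) _); by field.
  - move=> t u r t0 [q [q0 Eq]]; exists (q / t); split; first exact: divr_gt0.
    by rewrite scalerA mulrA divfK// gt_eqF.
  - move=> r [t [t0]]; rewrite scaler0 => /Ec; rewrite lerDl.
    by rewrite pmulr_rge0.
  - move=> u r [t [t0 /Erev[q [b [q0 Eb]]]]].
    exists ((b - c) / (q * t)), (q * t).
    have qt0 : 0 < q * t by exact: mulr_gt0.
    split=> //; rewrite scalerN -scalerA mulrCA divff ?gt_eqF// mulr1.
    by rewrite addrC subrK.
have [g Hg] := reversible_cone_minorant e us Kc.
exists g => u a x Eu ux; rewrite -lerBrDl; apply: Hg ux.
by exists 1; rewrite ltr01 scale1r mul1r addrC subrK.
Qed.

End ConvexMinorant.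

(** * Inner products and minorants in coordinates *)

Section Dot.
Context {R : realType}.
Implicit Types n : nat.

Lemma dotvC n (x y : 'cV[R]_n) : dotv x y = dotv y x.
Proof. by apply: eq_bigr => i _; rewrite mulrC. Qed.

Lemma dotvDl n (x y z : 'cV[R]_n) : dotv (x + y) z = dotv x z + dotv y z.
Proof. by rewrite -big_split; apply: eq_bigr => i _; rewrite mxE mulrDl. Qed.

Lemma dotvZl n (t : R) (x z : 'cV[R]_n) : dotv (t *: x) z = t * dotv x z.
Proof. by rewrite mulr_sumr; apply: eq_bigr => i _; rewrite mxE mulrA. Qed.

Lemma dotvNl n (x z : 'cV[R]_n) : dotv (- x) z = - dotv x z.
Proof. by rewrite -scaleN1r dotvZl mulN1r. Qed.

Lemma dotvDr n (x y z : 'cV[R]_n) : dotv z (x + y) = dotv z x + dotv z y.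
Proof. by rewrite !(dotvC z) dotvDl. Qed.

Lemma dotvZr n (t : R) (x z : 'cV[R]_n) : dotv z (t *: x) = t * dotv z x.
Proof. by rewrite !(dotvC z) dotvZl. Qed.

Lemma dotvNr n (x z : 'cV[R]_n) : dotv z (- x) = - dotv z x.
Proof. by rewrite !(dotvC z) dotvNl. Qed.

Lemma dotv0r n (x : 'cV[R]_n) : dotv x 0 = 0.
Proof. by rewrite -(scale0r 0) dotvZr mul0r. Qed.

Lemma dotv0l n (x : 'cV[R]_n) : dotv 0 x = 0.
Proof. by rewrite dotvC dotv0r. Qed.

Definition dotvE := (dotvDl, dotvDr, dotvNl, dotvNr, dotvZl, dotvZr).

Lemma dotv_mulmx m n (A : 'M[R]_(m, n)) (x : 'cV[R]_n) (y : 'cV[R]_m) :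
  dotv (A *m x) y = dotv x (A^T *m y).
Proof.
rewrite /dotv; under eq_bigr do rewrite mxE mulr_suml.
rewrite exchange_big; apply: eq_bigr => i _; rewrite mxE mulr_sumr.
by apply: eq_bigr => j _; rewrite mxE; ring.
Qed.

Lemma dotv_delta n (x : 'cV[R]_n) (i : 'I_n) : dotv x (delta_mx i 0) = x i 0.
Proof.
rewrite /dotv (bigD1 i)//= mxE !eqxx mulr1 big1 ?addr0// => j ji.
by rewrite mxE (negbTE ji) mulr0.
Qed.

Lemma colvE n (u : 'cV[R]_n) : u = \sum_i u i 0 *: delta_mx i 0.
Proof.
by rewrite {1}[u]matrix_sum_delta; apply: eq_bigr => i _; rewrite big_ord1.
Qed.

Lemma dotv_convex_minorant n (E : 'cV[R]_n -> R -> Prop) (c : R) :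
  (forall u v a b t, 0 < t < 1 -> E u a -> E v b ->
    E (t *: u + (1 - t) *: v) (t * a + (1 - t) * b)) ->
  (forall a, E 0 a -> c <= a) ->
  (forall u a, E u a -> exists t b, 0 < t /\ E (- (t *: u)) b) ->
  exists y : 'cV[R]_n, forall u a, E u a -> c + dotv y u <= a.
Proof.
move=> Econv Ec Erev.
have [g Hg] := convex_minorant (fun i : 'I_n => delta_mx i 0)
  (index_enum_uniq 'I_n) Econv Ec Erev.
exists (\col_i g i) => u a Eu; have := Hg u a _ Eu (colvE u).
by congr (_ + _ <= _); apply: eq_bigr => i _; rewrite mxE mulrC.
Qed.

Lemma dotvr_convex_minorant n (E : 'cV[R]_n * R -> R -> Prop) (c : R) :
  (forall u v a b t, 0 < t < 1 -> E u a -> E v b ->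
    E (t *: u + (1 - t) *: v) (t * a + (1 - t) * b)) ->
  (forall a, E 0 a -> c <= a) ->
  (forall u a, E u a -> exists t b, 0 < t /\ E (- (t *: u)) b) ->
  exists y : 'cV[R]_n * R, forall u a, E u a -> c + dotvr y u <= a.
Proof.
move=> Econv Ec Erev.
(* [None] indexes the scalar coordinate of the product space. *)
pose s := None :: [seq Some i | i <- index_enum 'I_n].
pose e (o : option 'I_n) : 'cV[R]_n * R :=
  if o is Some i then (delta_mx i 0, 0) else (0, 1).
have us : uniq s.
  rewrite /= map_inj_uniq ?index_enum_uniq ?andbT; last by move=> ? ? [].
  by apply/mapP => -[].
have [g Hg] := convex_minorant e us Econv Ec Erev.
exists (\col_i g (Some i), g None) => -[u t] a Eu.
have := Hg (u, t) a (fun o => if o is Some i then u i 0 else t) Eu.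
rewrite /s !big_cons !big_map /dotvr/= => H.
have -> : dotv (\col_i g (Some i)) u =
    \sum_(j <- index_enum 'I_n) u j 0 * g (Some j).
  by apply: eq_bigr => i _; rewrite mxE mulrC.
rewrite mulrC [_ + t * _]addrC; apply: H; rewrite /e.
transitivity ((0, t) + (u, 0) : 'cV[R]_n * R).
  by congr (_, _); rewrite /= ?add0r ?addr0.
congr (_ + _).
  by congr (_, _); rewrite /= ?scaler0// /GRing.scale/= mulr1.
rewrite [RHS]surjective_pairing (raddf_sum fst) (raddf_sum snd) /=.
congr (_, _); first exact: colvE.
by rewrite big1// => i _; exact: mulr0.
Qed.

End Dot.

(** * Gauges and polars *)

Section Gauges.
Context {R : realType}.
Implicit Types n : nat.

(** A linear function bounded above along a ray has nonpositive slope; this reads a constraint off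
    an inequality that holds at every scale. *)
Lemma le0_of_scaled (c x : R) : (forall t, 0 < t -> t * x <= c) -> x <= 0.
Proof.
move=> H; rewrite leNgt; apply/negP => x0.
have t0 : 0 < (`|c| + 1) / x by rewrite divr_gt0// ltr_wpDl.
have := H _ t0; rewrite divfK ?gt_eqF//.
by have := ler_norm c; lra.
Qed.

Lemma gauge_le_ge0 n (k : 'cV[R]_n -> \bar R) x (a : R) :
  gauge k -> (k x <= a%:E)%E -> 0 <= a.
Proof. by move=> gk kx; rewrite -lee_fin (le_trans _ kx)// gauge_ge0. Qed.

Lemma gauge_leZ n (k : 'cV[R]_n -> \bar R) x (a t : R) :
  gauge k -> 0 <= t -> (k x <= a%:E)%E -> (k (t *: x) <= (t * a)%:E)%E.
Proof.
move=> gk; rewrite le_eqVlt => /predU1P[<-|t0 kx].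
  by rewrite scale0r gauge0// mul0r.
by rewrite gauge_homogeneous// EFinM lee_pmul2l// fin_numE.
Qed.

Lemma gauge_leD n (k : 'cV[R]_n -> \bar R) x y (a b : R) :
  gauge k -> (k x <= a%:E)%E -> (k y <= b%:E)%E ->
  (k (x + y)%R <= (a + b)%:E)%E.
Proof.
move=> gk kx ky.
have h0 : 0 < (2^-1 : R) < 1 by lra.
have := gauge_convex gk (2 *: x) (2 *: y) h0.
rewrite (_ : 1 - 2^-1 = 2^-1); last by field.
rewrite !scalerA mulVf// !scale1r => /le_trans; apply.
have half z c : (k z <= c%:E)%E -> ((2^-1)%:E * k (2 *: z)%R <= c%:E)%E.
  by rewrite gauge_homogeneous// muleA -EFinM mulVf// mul1e.
by rewrite EFinD leeD// half.
Qed.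

Lemma polar_ge0 n (k : 'cV[R]_n -> \bar R) z : (0 <= polar k z)%E.
Proof. by apply: le_ereal_inf_tmp => _ [a [a0 _] <-]; rewrite lee_fin ltW. Qed.

(** The polar is the support function of the unit sublevel set of [k]. A point with 0 < k x < +oo is
    rescaled into that set; where k x = 0 the whole ray lies in it. *)
Lemma polar_lePP n (k : 'cV[R]_n -> \bar R) z (a : R) : gauge k ->
  (polar k z <= a%:E)%E <-> forall x, (k x <= 1)%E -> dotv x z <= a.
Proof.
move=> gk; split=> [pa x kx|H].
  rewrite leNgt; apply/negP => ax.
  have /ereal_inf_lt[_ [c [c0 kc] <-]] : (polar k z < (dotv x z)%:E)%E.
    by rewrite (le_lt_trans pa)// lte_fin.
  rewrite lte_fin ltNge -lee_fin (le_trans (kc x))//.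
  by rewrite -[leRHS]mule1 lee_pmul2l// fin_numE.
have a0 : 0 <= a by have := H 0; rewrite dotv0l; apply; rewrite gauge0.
(* The infimum ranges over positive mu while a may be 0, hence the slack e. *)
apply/lee_addgt0Pr => e e0; rewrite -EFinD.
have ae0 : 0 < a + e by rewrite ltr_wpDl.
apply: ereal_inf_lbound; exists (a + e) => //; split=> // x.
case kx : (k x) => [c||]; last 2 first.
- by rewrite gt0_muley ?lte_fin// leey.
- by have := gauge_ge0 gk x; rewrite kx.
have kxc : (k x <= c%:E)%E by rewrite kx.
have c0 : 0 <= c by exact: gauge_le_ge0 kxc.
rewrite -EFinM lee_fin -subr_le0.
have [c00|cn0] := eqVneq c 0.
  rewrite c00 mulr0 subr0; apply: (@le0_of_scaled a) => t t0.
  rewrite -dotvZl; apply: H; apply: le_trans (gauge_leZ gk (ltW t0) kxc) _.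
  by rewrite c00 mulr0 lee_fin.
have ci : 0 < c^-1 by rewrite invr_gt0 lt_def cn0.
have : c^-1 * dotv x z <= a.
  rewrite -dotvZl; apply: H; apply: le_trans (gauge_leZ gk (ltW ci) kxc) _.
  by rewrite mulVf.
rewrite mulrC ler_pdivrMr ?lt_def ?cn0// => H1.
by rewrite subr_le0 (le_trans H1)// ler_wpM2r// lerDl ltW.
Qed.

Lemma polar_le_dotv n (k : 'cV[R]_n -> \bar R) x z (a c : R) : gauge k ->
  (polar k z <= a%:E)%E -> (k x <= c%:E)%E -> dotv x z <= a * c.
Proof.
move=> gk pz kx; rewrite -subr_le0.
have a0 : 0 <= a by rewrite -lee_fin (le_trans (polar_ge0 k z)).
have c0 := gauge_le_ge0 gk kx.
apply: (@le0_of_scaled a) => t t0.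
(* Scaling x by t / (t c + 1) puts it in the unit sublevel set without dividing by c, which may be
   0. *)
have tc0 : 0 < t * c + 1 by rewrite ltr_wpDl// mulr_ge0// ltW.
have : dotv ((t / (t * c + 1)) *: x) z <= a.
  move/(polar_lePP _ _ gk): pz; apply.
  have tt0 : 0 <= t / (t * c + 1) by rewrite divr_ge0// ltW.
  apply: le_trans (gauge_leZ gk tt0 kx) _.
  by rewrite lee_fin mulrAC ler_pdivrMr// mul1r lerDl.
by rewrite dotvZl mulrAC ler_pdivrMr//; lra.
Qed.

Lemma polar_le_convex n (k : 'cV[R]_n -> \bar R) x z (a c t : R) : gauge k ->
  0 < t < 1 -> (polar k x <= a%:E)%E -> (polar k z <= c%:E)%E ->
  (polar k (t *: x + (1 - t) *: z)%R <= (t * a + (1 - t) * c)%:E)%E.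
Proof.
move=> gk /andP[t0 t1] /(polar_lePP _ _ gk) px /(polar_lePP _ _ gk) pz.
apply/(polar_lePP _ _ gk) => w kw; rewrite !dotvE.
by rewrite lerD// ler_wpM2l ?px ?pz// ?subr_ge0 ltW.
Qed.

Lemma polar_leD n (k : 'cV[R]_n -> \bar R) x z (a c : R) : gauge k ->
  (polar k x <= a%:E)%E -> (polar k z <= c%:E)%E ->
  (polar k (x + z)%R <= (a + c)%:E)%E.
Proof.
move=> gk /(polar_lePP _ _ gk) px /(polar_lePP _ _ gk) pz.
by apply/(polar_lePP _ _ gk) => w kw; rewrite !dotvE lerD ?px ?pz.
Qed.

Lemma polar_leZ n (k : 'cV[R]_n -> \bar R) x (a t : R) : gauge k -> 0 <= t ->
  (polar k x <= a%:E)%E -> (polar k (t *: x)%R <= (t * a)%:E)%E.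
Proof.
move=> gk t0 /(polar_lePP _ _ gk) px.
by apply/(polar_lePP _ _ gk) => w kw; rewrite !dotvE ler_wpM2l ?px.
Qed.

Lemma polar0_le n (k : 'cV[R]_n -> \bar R) : gauge k -> (polar k 0 <= 0)%E.
Proof. by move=> gk; apply/(polar_lePP _ _ gk) => w kw; rewrite dotv0r. Qed.

(* A subgradient at [w] of the finite inf-convolution of [k] with a large
   multiple of the norm separates [w] from the unit sublevel set of [k]. *)
Lemma bipolar_separation n (k : 'cV[R]_n -> \bar R) w (q : R) : gauge k ->
  1 < q -> (\forall x \near w, (q%:E < k x)%E) ->
  exists z, (polar k z <= 1)%E /\ q <= dotv w z.
Proof.
move=> gk q1 /nbhs_ballP[d /= d0 dk].
have q0 : 0 < q by lra.
(* With this slope the penalty alone reaches q at distance d from w. [E u a] says that a bounds the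
   inf-convolution at w + u, as witnessed by x. *)
pose N := q / d; have N0 : 0 < N by exact: divr_gt0.
pose E u a := exists x, (k x <= (a - N * `|w + u - x|)%:E)%E.
have [|||y Ey] := @dotv_convex_minorant R n E q.
- move=> u v a b t /andP[t0 t1] [x kx] [z kz].
  have s0 : 0 < 1 - t by rewrite subr_gt0.
  exists (t *: x + (1 - t) *: z).
  apply: le_trans (gauge_leD gk (gauge_leZ gk (ltW t0) kx)
    (gauge_leZ gk (ltW s0) kz)) _.
  rewrite lee_fin.
  have : `|w + (t *: u + (1 - t) *: v) - (t *: x + (1 - t) *: z)| <=
      t * `|w + u - x| + (1 - t) * `|w + v - z|.
    have nZ r (v' : 'cV[R]_n) : 0 < r -> r * `|v'| = `|r *: v'|.
      by move=> r0; rewrite normrZ gtr0_norm.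
    rewrite !nZ//.
    apply: le_trans (ler_normD _ _); rewrite le_eqVlt; apply/orP; left.
    by apply/eqP; congr `|_|; apply/colP => i; rewrite !mxE; ring.
  by move/(ler_wpM2l (ltW N0)); lra.
- move=> a [x kx]; rewrite addr0 in kx.
  have := gauge_le_ge0 gk kx; rewrite subr_ge0 => le_a.
  have [wx|] := ltP `|w - x| d.
    have : (q%:E < k x)%E by apply: dk; rewrite mx_norm_ball.
    move=> /lt_le_trans /(_ kx); rewrite lte_fin => /ltW /le_trans; apply.
    by rewrite gerBl mulr_ge0// ltW.
  move=> /(ler_wpM2l (ltW N0)); rewrite /N divfK ?gt_eqF// => /le_trans.
  exact.
(* x = 0 is always a witness, so every direction belongs to the domain. *)
- move=> u a [x kx]; exists 1, (N * `|w - u|); split=> //.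
  by exists 0; rewrite gauge0// scale1r subr0 subrr.
(* At w + u = M x the inf-convolution is at most M; letting M grow forces [dotv x y] <= 1. *)
have H M x : 0 < M -> (k x <= 1)%E -> M * (dotv x y - 1) <= dotv w y - q.
  move=> M0 kx; suff /Ey : E (M *: x - w) M.
    by rewrite !dotvE ![dotv y _]dotvC; lra.
  exists (M *: x); rewrite [w + _]addrC subrK subrr normr0 mulr0 subr0.
  rewrite -[M in M%:E]mulr1.
  exact: gauge_leZ (ltW M0) kx.
exists y; split.
  apply/(polar_lePP _ _ gk) => x kx; rewrite -subr_le0.
  by apply: (@le0_of_scaled (dotv w y - q)) => M M0; exact: H.
(* At the origin, u = - w, the value is at most 0, which gives q <= [dotv w y]. *)
have : E (- w) 0.
  by exists 0; rewrite subrr subr0 normr0 mulr0 subr0 gauge0.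
by move/Ey; rewrite !dotvE [dotv y w]dotvC; lra.
Qed.

(** Otherwise lower semicontinuity keeps [k] above some q > 1 near w, and separation gives a z in
    the polar unit set with [dotv w z] >= q > 1. *)
Lemma bipolar_le1 n (k : 'cV[R]_n -> \bar R) w : closed_gauge k ->
  (forall z, (polar k z <= 1)%E -> dotv w z <= 1) -> (k w <= 1)%E.
Proof.
move=> [gk /lower_semicontinuousP lk] H; rewrite leNgt; apply/negP => kw.
have [q q1 qk] : exists2 q : R, 1 < q & (q%:E < k w)%E.
  case: (k w) kw => [r||//] kw.
    by exists ((1 + r) / 2); rewrite ?lte_fin; move: kw; rewrite lte_fin; lra.
  by exists 2; rewrite ?ltr1n// ltey.
have [|z [/H pz qz]] := bipolar_separation gk q1 (w := w).
  exact: (open_nbhs_nbhs (conj (lk q) qk)).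
by have := le_trans qz pz; lra.
Qed.

Lemma bipolar_le n (k : 'cV[R]_n -> \bar R) w (c : R) : closed_gauge k ->
  0 < c -> (forall z, (polar k z <= 1)%E -> dotv w z <= c) -> (k w <= c%:E)%E.
Proof.
move=> ck c0 H; have gk := ck.1.
have /(gauge_leZ gk (ltW c0)) : (k (c^-1 *: w) <= 1)%E.
  apply: bipolar_le1 => // z /H.
  by rewrite dotvZl mulrC ler_pdivrMr// mul1r.
by rewrite scalerA divff ?gt_eqF// scale1r mulr1.
Qed.

Lemma indicator_leP (T : Type) (C : set T) x (a : R) :
  (indicator C x <= a%:E)%E <-> C x /\ 0 <= a.
Proof.
rewrite /indicator; case: ifPn => [/set_mem Cx|/negP xC]; rewrite ?lee_fin.
  by split=> [//|[]].
by split=> // -[/mem_set].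
Qed.

Lemma indicator_gauge n (C : set 'cV[R]_n) : C 0 ->
  (forall x y, C x -> C y -> C (x + y)) ->
  (forall t x, 0 < t -> C x -> C (t *: x)) -> gauge (indicator (R := R) C).
Proof.
move=> C0 CD CZ; split.
- by move=> x; rewrite /indicator; case: ifP.
- move=> x y t /andP[t0 t1]; rewrite {2 3}/indicator.
  have s0 : 0 < 1 - t by rewrite subr_gt0.
  case: ifPn => [/set_mem Cx|_]; case: ifPn => [/set_mem Cy|_].
  + rewrite !mule0 adde0; apply/indicator_leP; split=> //.
    by apply: CD; exact: CZ.
  + by rewrite mule0 add0e gt0_muley ?lte_fin// leey.
  + by rewrite mule0 adde0 gt0_muley ?lte_fin// leey.
  + by rewrite !gt0_muley ?lte_fin// leey.
- move=> t x t0; rewrite /indicator.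
  have -> : (t *: x \in C) = (x \in C).
    apply/idP/idP => /set_mem Cx; apply/mem_set; last exact: CZ.
    by rewrite -(scalerK (lt0r_neq0 t0) x); apply: CZ => //; rewrite invr_gt0.
  by case: ifP; rewrite ?mule0 ?gt0_muley ?lte_fin.
- by rewrite /indicator mem_set.
Qed.

End Gauges.

(** * The case sigma = 0 *)

Section ZeroSigma.
Context {R : realType}.
Implicit Types n : nat.

Lemma zero_setE n (k : 'cV[R]_n -> \bar R) :
  gauge k -> zero_set k = [set x | (k x <= 0)%E].
Proof.
move=> gk; apply/seteqP; split=> x /=; first by rewrite /zero_set/= => ->.
by move=> kx; apply/le_anti; rewrite kx gauge_ge0.
Qed.

Lemma zero_set_gauge n (k : 'cV[R]_n -> \bar R) :
  gauge k -> gauge (indicator (R := R) (zero_set k)).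
Proof.
move=> gk; rewrite zero_setE//; apply: indicator_gauge => /=.
- by rewrite gauge0.
- by move=> x y kx ky; have := gauge_leD gk kx ky; rewrite addr0.
- by move=> t x t0 kx; have := gauge_leZ gk (ltW t0) kx; rewrite mulr0.
Qed.

(** A strict superlevel set of the indicator is the whole space for a negative level and {0 < k}
    otherwise. *)
Lemma zero_set_closed_gauge n (k : 'cV[R]_n -> \bar R) :
  closed_gauge k -> closed_gauge (indicator (R := R) (zero_set k)).
Proof.
move=> [gk /lower_semicontinuousP lk]; split; first exact: zero_set_gauge.
apply/lower_semicontinuousP => a; have [a0|a0] := ltP a 0.
  rewrite (_ : [set x | _] = setT); first exact: openT.
  apply/seteqP; split=> // x _ /=.
  rewrite (@lt_le_trans _ _ 0%E)// ?lte_fin//.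
  exact: gauge_ge0 (zero_set_gauge gk) x.
rewrite (_ : [set x | _] = [set x | (0%:E < k x)%E]); first exact: lk.
apply/seteqP; split=> x /=; rewrite ltNge => /negP H; rewrite ltNge;
  apply/negP => kx; apply: H.
  by apply/indicator_leP; rewrite zero_setE.
by move/indicator_leP : kx; rewrite zero_setE// => -[].
Qed.

Lemma dotv_continuous n (x : 'cV[R]_n) : continuous (fun y => dotv x y).
Proof.
apply: continuous_big; first exact: add_continuous.
move=> i _ y; apply: (@cvgMr _ _ (nbhs y)); exact: coord_continuous.
Qed.

(* By the bipolar theorem the closure of [dom (polar k)] is the polar cone of
   [zero_set k], whose indicator is the polar of [indicator (zero_set k)]. *)
Lemma polar_indicator_zero_set n (k : 'cV[R]_n -> \bar R) y :
  closed_gauge k ->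
  polar (indicator (zero_set k)) y = indicator (closure (dom (polar k))) y.
Proof.
move=> ck; have gk := ck.1; have gH := zero_set_gauge gk.
have dom_le v : dom (polar k) v -> exists a : R, (polar k v <= a%:E)%E.
  rewrite /dom/=; have := polar_ge0 k v.
  by case: (polar k v) => // a _ _; exists a.
rewrite [RHS]/indicator; case: ifPn => [/set_mem ycl|/negP ycl].
  apply/le_anti; rewrite polar_ge0 andbT; apply/(polar_lePP _ _ gH) => x.
  move=> /indicator_leP[+ _]; rewrite zero_setE//= => kx.
  have /closure_id clE : closed [set v | dotv x v <= 0].
    apply: (@closed_comp _ _ (fun v => dotv x v) [set r | r <= 0]).
      by move=> v _; exact: dotv_continuous.
    exact: closed_le.
  suff : [set v | dotv x v <= 0] y by [].
  rewrite clE; apply: closureS ycl => v /dom_le[a pa] /=.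
  by have := polar_le_dotv gk pa kx; rewrite mulr0.
have gK : gauge (indicator (R := R) (dom (polar k))).
  apply: indicator_gauge; rewrite /dom/=.
  - by rewrite (le_lt_trans (polar0_le gk)).
  - move=> u v /dom_le[a ua] /dom_le[c vc].
    by rewrite (le_lt_trans (polar_leD gk ua vc))// ltry.
  - move=> t u t0 /dom_le[a ua].
    by rewrite (le_lt_trans (polar_leZ gk (ltW t0) ua))// ltry.
(* y is separated from the cone [dom (polar k)] through the indicator of that cone, at a level above
   1. *)
have q1 : 1 < (2 : R) by rewrite ltr1n.
have [|z [pz yz]] := bipolar_separation gK q1 (w := y).
  have : (~` dom (polar k))° y by rewrite interiorC => /mem_set.
  apply: filterS => v /= kv; rewrite ltNge; apply/negP.
  by move=> /indicator_leP[].
(* The indicator vanishes on the cone, so [pz] gives [dotv z v] <= 0 there and the bipolar theorem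
   bounds k z by every e > 0. *)
have zH : zero_set k z.
  rewrite zero_setE//=; apply/lee_addgt0Pr => e e0; rewrite add0e.
  apply: bipolar_le => // v pv.
  have : (indicator (dom (polar k)) v <= (0 : R)%:E)%E.
    by apply/indicator_leP; split=> //; rewrite /dom/= (le_lt_trans pv)// ltry.
  move=> /(polar_le_dotv gK pz); rewrite mulr0 dotvC => /le_trans; apply.
  exact: ltW.
(* A finite polar at y would force [dotv y z] <= 0, against [yz]. *)
case py : (polar _ y) => [a|//|]; last first.
  by have := polar_ge0 (indicator (zero_set k)) y; rewrite py.
have pya : (polar (indicator (zero_set k)) y <= a%:E)%E by rewrite py.
have : (indicator (zero_set k) z <= (0 : R)%:E)%E by apply/indicator_leP.
move=> /(polar_le_dotv gH pya); rewrite mulr0 dotvC => /(le_trans yz).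
by rewrite lern0.
Qed.

End ZeroSigma.

(** * Uniform treatment of sigma = 0 and sigma > 0 *)

Section Reduction.
Context {R : realType} {m : nat}.
Variables (rho : 'cV[R]_m -> \bar R) (sigma : R) (b : 'cV[R]_m).
Hypotheses (crho : closed_gauge rho) (sigma_ge0 : 0 <= sigma).

Lemma vf_sigma_gt0 : 0 < vf_sigma sigma.
Proof. by rewrite /vf_sigma; case: eqVneq => // s0; rewrite lt_def s0. Qed.

Lemma vf_rho_closed_gauge : closed_gauge (vf_rho rho sigma).
Proof. by rewrite /vf_rho; case: ifP => // _; exact: zero_set_closed_gauge. Qed.

Lemma primal_setE (x : 'cV[R]_m) : (rho x <= sigma%:E)%E <->
  (vf_rho rho sigma x <= (vf_sigma sigma)%:E)%E.
Proof.
rewrite /vf_rho /vf_sigma; case: eqVneq => // ->; have zE := zero_setE crho.1.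
split=> [rx|/indicator_leP[]]; first by apply/indicator_leP; rewrite zE.
by rewrite zE.
Qed.

Lemma scaled_polarE (y : 'cV[R]_m) :
  scaled_polar rho sigma y
    = ((vf_sigma sigma)%:E * polar (vf_rho rho sigma) y)%E.
Proof.
rewrite /scaled_polar /vf_rho /vf_sigma; case: eqVneq => // _.
by rewrite mul1e polar_indicator_zero_set.
Qed.

(** A real bound a replaces the extended-real subtraction: an infinite polar makes the difference
    -oo and so excludes y. *)
Lemma dual_levelP (theta : R) (y : 'cV[R]_m) :
  dual_level rho b sigma theta y <->
  exists a : R, (polar (vf_rho rho sigma) y <= a%:E)%E /\
    1 + theta + vf_sigma sigma * a <= dotv b y.
Proof.
rewrite /dual_level/= scaled_polarE; have s0 := vf_sigma_gt0.
split=> [|[a [pa]]].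
  have := polar_ge0 (vf_rho rho sigma) y.
  case: (polar _ y) => [a _||//].
    by rewrite -EFinM -EFinB lee_fin => H; exists a; split=> //; lra.
  by rewrite gt0_muley ?lte_fin// addeNy.
have := polar_ge0 (vf_rho rho sigma) y.
case: (polar _ y) pa => [c||//]; last by rewrite leye_eq.
rewrite -EFinM -EFinB !lee_fin => ca _ H.
by have := ler_wpM2l (ltW s0) ca; lra.
Qed.

Lemma dual_setE : dual_set rho b sigma = dual_level rho b sigma 0.
Proof. by rewrite /dual_level addr0. Qed.

End Reduction.

(** * Relative interiors *)

Section RelativeInterior.
Context {R : realType}.
Implicit Types n : nat.

(** x + d (x - z) is an affine combination of x and z, so it stays in the affine hull, and a small d
    keeps it in the ball given by [ri]. *)
Lemma ri_prolong n (C : set 'cV[R]_n) x z : ri C x -> C z ->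
  exists2 e : R, 0 < e & forall d, 0 < d <= e -> C (x + d *: (x - z)).
Proof.
move=> [Cx] /nbhs_ballP[e /= e0 xe] Cz.
have N0 : 0 < `|x - z| + 1 by rewrite ltr_wpDl.
(* The summand 1 avoids a division by 0 when z = x. *)
exists (e / 2 / (`|x - z| + 1)); first by rewrite !divr_gt0.
move=> d /andP[d0 de]; apply: xe.
  rewrite mx_norm_ball /ball_/= opprD addNKr normrN normrZ gtr0_norm//.
  have : d * (`|x - z| + 1) <= e / 2 by rewrite -ler_pdivlMr.
  by rewrite mulrDr; lra.
move=> M [Maff CM].
have -> : x + d *: (x - z) = (1 + d) *: x + (1 - (1 + d)) *: z.
  by apply/colP => i; rewrite !mxE; ring.
by apply: Maff; exact: CM.
Qed.

Lemma col_norm_le n (x : 'cV[R]_n) (M : R) :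
  0 <= M -> (forall i, `|x i 0| <= M) -> `|x| <= M.
Proof.
move=> M0 xM; rewrite [`|x|]mx_normrE; apply: bigmax_le => // -[i j] _.
by rewrite (ord1 j).
Qed.

(** Supplies the test points of both boundedness claims: an upper bound along plus and minus an axis
    bounds that coordinate. *)
Lemma interior_prolong n (C : set 'cV[R]_n) x : interior C x ->
  exists2 e : R, 0 < e & forall i : 'I_n,
    C (x + e *: delta_mx i 0) /\ C (x - e *: delta_mx i 0).
Proof.
move=> /nbhs_ballP[e /= e0 xe]; exists (e / 2); first exact: divr_gt0.
have dn (i : 'I_n) : `|delta_mx i 0 : 'cV[R]_n| <= 1.
  apply: col_norm_le => // j.
  by rewrite mxE normr_nat lern1 leq_b1.
have dn' i : `|(e / 2) *: (delta_mx i 0 : 'cV[R]_n)| < e.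
  rewrite normrZ gtr0_norm ?divr_gt0//.
  have e20 : 0 <= e / 2 by rewrite divr_ge0 ?ltW.
  have := ler_wpM2l e20 (dn i); lra.
move=> i; split; apply: xe; rewrite mx_norm_ball /ball_/=.
  by rewrite opprD addNKr normrN.
by rewrite opprB addrC subrK.
Qed.

Lemma bounded_set_coord n (S : set 'cV[R]_n) :
  (forall i, exists M : R, forall x, S x -> `|x i 0| <= M) -> bounded_set S.
Proof.
move=> /choice[M SM]; exists (\sum_i `|M i|); split; first exact: num_real.
move=> N MN x Sx /=; apply: col_norm_le => [|i].
  by rewrite (le_trans _ (ltW MN))// sumr_ge0.
rewrite (le_trans (SM _ _ Sx))// (le_trans (ler_norm _))//.
by rewrite (le_trans _ (ltW MN))// (bigD1 i)//= lerDl sumr_ge0.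
Qed.

End RelativeInterior.

(** * Value functions and duality *)

Section Duality.
Context {R : realType} {m n : nat}.
Variables (kappa : 'cV[R]_n -> \bar R) (r : 'cV[R]_m -> \bar R).
Variables (A : 'M[R]_(m, n)) (b : 'cV[R]_m) (s : R).
Hypotheses (ckappa : closed_gauge kappa) (cr : closed_gauge r) (s_gt0 : 0 < s).

Let gkappa := ckappa.1.
Let gr := cr.1.

(* [p u] is the infimum of [- l] over [p_hypo u l]. *)
Definition p_hypo (u : 'cV[R]_m) (l : R) : Prop :=
  0 <= l /\ exists w : 'cV[R]_n,
    (r (l *: b - A *m w + u)%R <= (s * l)%:E)%E /\ (kappa w <= 1%:E)%E.

(* Real upper bounds [a] and [v] stand in for the extended-real values of the
   polars. *)
Definition dual_slack (theta : R) (y : 'cV[R]_m) : Prop :=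
  exists a : R, (polar r y <= a%:E)%E /\ 1 + theta + s * a <= dotv b y.

Definition d_epi (z : 'cV[R]_n * R) (v : R) : Prop :=
  exists y, dual_slack z.2 y /\ (polar kappa (A^T *m y + z.1)%R <= v%:E)%E.

(** From right to left this is weak duality: pair w with A^T y and the residual with y. Conversely,
    suitable test points isolate each constraint in turn. *)
Lemma p_minorantP (y : 'cV[R]_m) (c : R) :
  (forall u l, p_hypo u l -> l + dotv y u <= c) <->
  dual_slack 0 y /\ (polar kappa (A^T *m y) <= c%:E)%E.
Proof.
split=> [H|[[a [pa ay]] pc] u l [l0 [w [rw kw]]]]; last first.
  have := polar_le_dotv gr pa rw; have := polar_le_dotv gkappa pc kw.
  rewrite !dotvE dotv_mulmx [dotv y u]dotvC.
  by have := ler_wpM2l l0 ay; lra.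
(* With w = 0, l = t and u = t (q - b) the hypothesis reads t (1 + [dotv y (q - b)]) <= c; let t
   grow. *)
have H1 q : (r q <= s%:E)%E -> dotv y q <= dotv b y - 1.
  move=> rq; rewrite -subr_le0; apply: (@le0_of_scaled _ c) => t t0.
  have /H : p_hypo (t *: q - t *: b) t.
    split; first exact: ltW.
    exists 0; rewrite gauge0//; split; last by rewrite lee_fin.
    rewrite mulmx0 subr0 addrC subrK mulrC.
    exact: gauge_leZ (ltW t0) rq.
  by rewrite !dotvE [dotv y b]dotvC; lra.
split; last first.
  apply/(polar_lePP _ _ gkappa) => w kw; rewrite -dotv_mulmx dotvC.
  (* With l = 0 and u = A w the residual vanishes, which leaves [dotv y (A *m w)] <= c. *)
  have /H : p_hypo (A *m w) 0.
    by split=> //; exists w; rewrite scale0r sub0r addNr gauge0 ?mulr0.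
  by rewrite add0r.
(* [H1] bounds the support function of {r <= s}, which is s times the polar of [r]. *)
exists ((dotv b y - 1) / s); split; last by rewrite mulrCA divff ?gt_eqF//; lra.
apply/(polar_lePP _ _ gr) => q rq; rewrite dotvC ler_pdivlMr// mulrC -dotvZr.
by apply: H1; have := gauge_leZ gr (ltW s_gt0) rq; rewrite mulr1.
Qed.

Lemma p_hypo_convex u v (a c t : R) : 0 < t < 1 -> p_hypo u a -> p_hypo v c ->
  p_hypo (t *: u + (1 - t) *: v) (t * a + (1 - t) * c).
Proof.
move=> /andP[t0 t1] [a0 [w [rw kw]]] [c0 [x [rx kx]]].
have q0 : 0 < 1 - t by rewrite subr_gt0.
split; first by rewrite addr_ge0// mulr_ge0// ltW.
exists (t *: w + (1 - t) *: x); split.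
  have := gauge_leD gr (gauge_leZ gr (ltW t0) rw) (gauge_leZ gr (ltW q0) rx).
  rewrite mulmxDr -!scalemxAr; congr (r _ <= _%:E)%E; last by ring.
  by apply/colP => i; rewrite !mxE; ring.
have := gauge_leD gkappa (gauge_leZ gkappa (ltW t0) kw)
  (gauge_leZ gkappa (ltW q0) kx).
by rewrite !mulr1 [t + _]addrC subrK.
Qed.

(* Adding the base point [(x0, 1)] makes [l] positive, so that the ray can be
   rescaled into the feasible set and prolonged beyond [x0]. *)
Lemma p_hypo_reversible (x0 : 'cV[R]_n) (u : 'cV[R]_m) (l : R) :
  ri [set z | (r (b - z)%R <= s%:E)%E] (A *m x0) -> ri (dom kappa) x0 ->
  p_hypo u l -> exists t k, 0 < t /\ p_hypo (- (t *: u)) k.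
Proof.
move=> riF riK [l0 [w [rw kw]]].
have rx0 : (r (b - A *m x0)%R <= s%:E)%E by case: riF.
have [c kx0] : exists c : R, (kappa x0 <= c%:E)%E.
  case: riK => + _; rewrite /dom/=; have := gauge_ge0 gkappa x0.
  by case: (kappa x0) => // c _ _; exists c.
have l1 : 0 < l + 1 by rewrite ltr_wpDl.
have li : 0 <= (l + 1)^-1 by rewrite invr_ge0 ltW.
(* The sum of (w, l) and (x0, 1) is scaled to multiplier 1: b - z is (l b - A w + u) + (b - A x0)
   divided by l + 1, so z is feasible. *)
pose x1 := (l + 1)^-1 *: (w + x0).
pose z := A *m x1 - (l + 1)^-1 *: u.
have lbE : b = (l + 1)^-1 *: (l *: b + b).
  by rewrite -{3}[b]scale1r -scalerDl scalerA mulVf ?scale1r// gt_eqF.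
have [|e1 e10 He1] := ri_prolong riF (z := z).
  have := gauge_leZ gr li (gauge_leD gr rw rx0).
  rewrite (_ : _ * _ = s); last by field; rewrite gt_eqF.
  congr (r _ <= _)%E; rewrite [in RHS]lbE /z /x1 -scalemxAr mulmxDr.
  by apply/colP => i; rewrite !mxE; ring.
have [|e2 e20 He2] := ri_prolong riK (z := x1).
  rewrite /dom/=; apply: le_lt_trans (gauge_leZ gkappa li
    (gauge_leD gkappa kw kx0)) (ltry _).
pose d := Num.min e1 e2.
have d0 : 0 < d by rewrite lt_min e10.
have /= rd : (r (b - (A *m x0 + d *: (A *m x0 - z)))%R <= s%:E)%E.
  by apply: He1; rewrite d0 ge_min lexx.
pose x2 := x0 + d *: (x0 - x1).
have [k k0 kx2] : exists2 k : R, 0 < k & (kappa x2 <= k%:E)%E.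
  have : dom kappa x2 by apply: He2; rewrite d0 ge_min lexx orbT.
  rewrite /dom/=; have := gauge_ge0 gkappa x2.
  case: (kappa x2) => // k; rewrite lee_fin => k0 _.
  by exists (k + 1); rewrite ?ltr_wpDl// lee_fin lerDl.
have ki : 0 < k^-1 by rewrite invr_gt0.
(* b minus the prolonged point equals b - A x2 - (d / (l + 1)) u; dividing by k brings kappa x2 to
   at most 1. *)
exists (k^-1 * (d * (l + 1)^-1)), k^-1; split.
  by rewrite !mulr_gt0// invr_gt0.
split; first exact: ltW.
exists (k^-1 *: x2); split.
  have := gauge_leZ gr (ltW ki) rd; rewrite [s * _]mulrC.
  congr (r _ <= _)%E; rewrite -!scalerA -scalemxAr -scalerBr -scalerBr.
  congr (_ *: _); rewrite /z /x2 mulmxDr -[A *m (d *: _)]scalemxAr mulmxBr.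
  by apply/colP => i; rewrite !mxE; ring.
by have := gauge_leZ gkappa (ltW ki) kx2; rewrite mulVf// gt_eqF.
Qed.

Lemma p_minorant_exists (x0 : 'cV[R]_n) (c : R) :
  ri [set z | (r (b - z)%R <= s%:E)%E] (A *m x0) -> ri (dom kappa) x0 ->
  (forall l, p_hypo 0 l -> l <= c) ->
  exists y, forall u l, p_hypo u l -> l + dotv y u <= c.
Proof.
move=> riF riK Hc.
have [|||y Hy] := @dotv_convex_minorant R m (fun u a => p_hypo u (- a)) (- c).
- move=> u v a d t t01 Pu Pv; have := p_hypo_convex t01 Pu Pv.
  by congr (p_hypo _ _); ring.
- by move=> a /Hc; lra.
- move=> u a /(p_hypo_reversible riF riK)[t [k [t0 Pk]]].
  by exists t, (- k); rewrite opprK.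
exists y => u l Pu; have := Hy u (- l); rewrite opprK => /(_ Pu); lra.
Qed.

(** Weak duality gives one direction and test points the other. The tests reach [kappa] and [r] only
    through their polars, so closedness enters by the bipolar theorem. *)
Lemma d_minorantP (w : 'cV[R]_n) (l c : R) : 0 < c ->
  (forall z v, d_epi z v -> c + dotvr (w, l) z <= v) <->
  [/\ (kappa w <= 1)%E, (r (l *: b - A *m w)%R <= (s * l)%:E)%E & c <= l].
Proof.
move=> c0; split=> [H|[kw rw cl] [t th] v [y [[a [pa ay]] pv]]]; last first.
  have l0 : 0 <= l by apply: le_trans cl; exact: ltW.
  have := polar_le_dotv gr pa rw; have := polar_le_dotv gkappa pv kw.
  rewrite /dotvr !dotvE dotv_mulmx /=.
  by have := ler_wpM2l l0 ay; rewrite /=; lra.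
(* At theta = - 1 the point y = 0 is admissible, so z is arbitrary. *)
have H0 z v : (polar kappa z <= v%:E)%E -> c + dotv w z - l <= v.
  move=> pz; have := H (z, -1) v; rewrite /dotvr/= mulrN1 addrA; apply.
  exists 0; split; last by rewrite mulmx0 add0r.
  exists 0; split; first exact: polar0_le.
  by rewrite dotv0r mulr0 addr0 subrr.
have cl : c <= l.
  by have := H0 0 0 (polar0_le gkappa); rewrite dotv0r; lra.
split=> //.
  apply: bipolar_le1 => // z pz; rewrite -subr_le0.
  apply: (@le0_of_scaled _ (l - c)) => t t0.
  have := polar_leZ gkappa (ltW t0) pz; rewrite mulr1 => /H0.
  by rewrite dotvZr; lra.
have l0 : 0 < l by exact: lt_le_trans cl.
apply: bipolar_le => //; first exact: mulr_gt0.
move=> y py; rewrite -subr_le0; apply: (@le0_of_scaled _ (l - c)) => t t0.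
(* This z cancels the argument of the objective, and theta is the level that t y reaches when its
   polar is bounded by t. *)
have := H (- (A^T *m (t *: y)), dotv b (t *: y) - 1 - s * t) 0.
rewrite /dotvr/= !dotvE dotv_mulmx -!scalemxAr !dotvE => H1.
suff /H1 : d_epi (- (t *: (A^T *m y)), t * dotv b y - 1 - s * t) 0 by lra.
exists (t *: y); split.
  exists t; split; last by rewrite /= dotvE; lra.
  by have := polar_leZ gr (ltW t0) py; rewrite mulr1.
by rewrite /= -scalemxAr subrr polar0_le.
Qed.

Lemma dual_slack_convex y z (p q t : R) : 0 < t < 1 ->
  dual_slack p y -> dual_slack q z ->
  dual_slack (t * p + (1 - t) * q) (t *: y + (1 - t) *: z).
Proof.
move=> t01 [a [pa ay]] [d [pd dz]].
exists (t * a + (1 - t) * d); split; first exact: polar_le_convex.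
have /andP[t0 t1] := t01; have q0 : 0 <= 1 - t by rewrite subr_ge0 ltW.
rewrite !dotvE.
by have := ler_wpM2l (ltW t0) ay; have := ler_wpM2l q0 dz; lra.
Qed.

(** The full right-hand side 1 + theta adds up under conic combinations, giving 1 + p + t (1 +
    q). *)
Lemma dual_slackD y z (p q t : R) : 0 <= t ->
  dual_slack p y -> dual_slack q z ->
  dual_slack (p + t * (1 + q)) (y + t *: z).
Proof.
move=> t0 [a [pa ay]] [d [pd dz]].
exists (a + t * d); split; first exact: polar_leD (polar_leZ gr t0 pd).
by rewrite !dotvE; have := ler_wpM2l t0 dz; lra.
Qed.

Lemma dual_slack_le y (p q : R) : p <= q -> dual_slack q y -> dual_slack p y.
Proof. by move=> pq [a [pa ay]]; exists a; split=> //; lra. Qed.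

(** Prolongs beyond y0 in the feasible set and beyond A^T y0 in the domain with a common step;
    multiples of y0 absorb the shift th of the level. *)
Lemma d_epi_reversible (y0 : 'cV[R]_m) (z : 'cV[R]_n * R) (v : R) :
  ri (dual_slack 0) y0 -> ri (dom (polar kappa)) (A^T *m y0) ->
  d_epi z v -> exists t k, 0 < t /\ d_epi (- (t *: z)) k.
Proof.
case: z => t th riF riK [y [/= Fy pv]].
have Fy0 : dual_slack 0 y0 by case: riF.
(* The term |th| y0 makes up for a negative th, so this point is dual feasible. *)
have [|e1 e10 He1] := ri_prolong riF (z := y + `|th| *: y0).
  apply: dual_slack_le (dual_slackD (normr_ge0 th) Fy Fy0).
  by have := ler_norm (- th); rewrite normrN; lra.
have [|e2 e20 He2] := ri_prolong riK (z := A^T *m y + t).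
  by rewrite /dom/= (le_lt_trans pv)// ltry.
pose d := Num.min e1 e2.
have d0 : 0 < d by rewrite lt_min e10.
have de1 : 0 < d <= e1 by rewrite d0 ge_min lexx.
have de2 : 0 < d <= e2 by rewrite d0 ge_min lexx orbT.
have dth : 0 <= d * `|th| by rewrite mulr_ge0// ltW.
(* Of the two added copies of d |th| y0, one cancels the same term of the prolonged point and the
   other costs d |th| c; the slack rises to 2 d |th|, above - d th. *)
have F1 := dual_slackD dth (dual_slackD dth (He1 _ de1) Fy0) Fy0.
have [c pc] : exists c : R, (polar kappa (A^T *m y0) <= c%:E)%E.
  case: riK => + _; rewrite /dom/=; have := polar_ge0 kappa (A^T *m y0).
  by case: (polar _ _) => // c _ _; exists c.
have [k pk] : exists k : R,
    (polar kappa (A^T *m y0 + d *: (A^T *m y0 - (A^T *m y + t)))%R <= k%:E)%E.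
  have := He2 _ de2; rewrite /dom/=.
  set q := A^T *m y0 + _; have := polar_ge0 kappa q.
  by case: (polar _ _) => // k _ _; exists k.
exists d, (k + d * `|th| * c); split=> //.
eexists; split => /=; first apply: dual_slack_le F1.
  rewrite [X in - X](_ : _ = d * th)//.
  by have := ler_wpM2l (ltW d0) (ler_norm (- th)); rewrite normrN; lra.
have := polar_leD gkappa pk (polar_leZ gkappa dth pc).
congr (polar _ _ <= _)%E.
rewrite !(mulmxDr, mulmxN, =^~ scalemxAr).
by apply/colP => i; rewrite !mxE; ring.
Qed.

Lemma d_minorant_exists (y0 : 'cV[R]_m) (c : R) :
  ri (dual_slack 0) y0 -> ri (dom (polar kappa)) (A^T *m y0) ->
  (forall v, d_epi (0, 0) v -> c <= v) ->
  exists wl, forall z v, d_epi z v -> c + dotvr wl z <= v.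
Proof.
move=> riF riK Hc; apply: dotvr_convex_minorant => //.
- move=> [t p] [u q] v d k k01 [y [Fy py]] [z [Fz pz]].
  exists (k *: y + (1 - k) *: z); split; first exact: dual_slack_convex.
  have := polar_le_convex gkappa k01 py pz; rewrite /=.
  congr (polar _ _ <= _)%E; rewrite !(mulmxDr, mulmxN, =^~ scalemxAr).
  by apply/colP => i; rewrite !mxE; ring.
- by move=> z v; exact: (d_epi_reversible riF riK).
Qed.

End Duality.

(** * Value functions and their subdifferentials at the origin *)

Section Values.
Context {R : realType} {m n : nat}.
Variables (kappa : 'cV[R]_n -> \bar R) (rho : 'cV[R]_m -> \bar R).
Variables (A : 'M[R]_(m, n)) (b : 'cV[R]_m) (sigma : R).
Hypotheses (ckappa : closed_gauge kappa) (crho : closed_gauge rho).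
Hypothesis sigma_ge0 : 0 <= sigma.

Local Notation r := (vf_rho rho sigma).
Local Notation s := (vf_sigma sigma).
Local Notation hypo := (p_hypo kappa r A b s).
Local Notation slack := (dual_slack r b s).
Local Notation epi := (d_epi kappa r A b s).

Let gkappa := ckappa.1.
Let cr : closed_gauge r := vf_rho_closed_gauge sigma crho.
Let gr := cr.1.
Let s_gt0 : 0 < s := vf_sigma_gt0 sigma_ge0.

Lemma primal_set_vf :
  primal_set rho b sigma = [set z | (r (b - z)%R <= s%:E)%E].
Proof.
by apply/seteqP; split=> z /=; move/(primal_setE sigma crho).
Qed.

Lemma dual_set_slack : dual_set rho b sigma = slack 0.
Proof.
rewrite dual_setE; apply/seteqP.
by split=> y; move/(dual_levelP b crho sigma_ge0 0 y).
Qed.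

Lemma le_p_valueP u (c : R) :
  (c%:E <= p_value kappa rho A b sigma u)%E <-> forall l, hypo u l -> l <= - c.
Proof.
split=> [H l Pl|H].
  by rewrite -lerNr -lee_fin (le_trans H)//; apply: ereal_inf_lbound; exists l.
by apply: le_ereal_inf_tmp => _ [l Pl <-]; rewrite lee_fin lerNr; exact: H.
Qed.

Lemma le_v_dP z (c : R) :
  (c%:E <= v_d kappa rho A b sigma z)%E <-> forall v, epi z v -> c <= v.
Proof.
split=> [H v [y [Fy py]]|H].
  rewrite -lee_fin (le_trans H)// (le_trans _ py)//.
  apply: ereal_inf_lbound; exists y => //.
  exact/(dual_levelP b crho sigma_ge0).
apply: le_ereal_inf_tmp => _ [y /(dual_levelP b crho sigma_ge0) Fy <-].
have p0 := polar_ge0 kappa (A^T *m y + z.1).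
case pv : (polar _ _) p0 => [v||] p0; [|by rewrite leey|by []].
by rewrite lee_fin; apply: H; exists y; split=> //; rewrite pv.
Qed.

(** Change of variables l = 1 / mu, w = x / mu, by homogeneity of both gauges. *)
Lemma v_p_setE u (mu : R) : 0 < mu ->
  (exists x : 'cV[R]_n, (r (b - A *m x + mu *: u)%R <= s%:E)%E /\
    (kappa x <= mu%:E)%E) <-> hypo u mu^-1.
Proof.
move=> mu0; have mui : 0 < mu^-1 by rewrite invr_gt0.
split=> [[x [rx kx]]|[_ [w [rw kw]]]].
  split; first exact: ltW.
  exists (mu^-1 *: x); split.
    have := gauge_leZ gr (ltW mui) rx; rewrite [s * _]mulrC.
    congr (r _ <= _)%E; rewrite scalerDr scalerBr scalemxAr.
    by rewrite scalerA mulVf ?scale1r// gt_eqF.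
  by have := gauge_leZ gkappa (ltW mui) kx; rewrite mulVf// gt_eqF.
exists (mu *: w); split.
  have := gauge_leZ gr (ltW mu0) rw; rewrite [s * _]mulrC mulVKf ?gt_eqF//.
  congr (r _ <= _)%E; rewrite scalerDr scalerBr scalemxAr.
  by rewrite scalerA mulfV ?scale1r// gt_eqF.
by have := gauge_leZ gkappa (ltW mu0) kw; rewrite mulr1.
Qed.

(** Under l = 1 / mu both infima range over the same points, except for l = 0, which contributes
    only the value 0 to [p_value]; inversion reverses the order. *)
Lemma neg_inv_v_pE :
  neg_inv_v_p kappa rho A b sigma = p_value kappa rho A b sigma.
Proof.
apply/funext => u; rewrite /neg_inv_v_p; case: ifPn => // vy.
set v := v_p _ _ _ _ _ _ in vy *; set p := p_value _ _ _ _ _ _.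
have v_lb mu : 0 < mu -> hypo u mu^-1 -> (v <= mu%:E)%E.
  move=> mu0 /(v_p_setE _ mu0) H.
  by apply: ereal_inf_lbound; exists mu.
have p_lb l : hypo u l -> (p <= (- l)%:E)%E.
  by move=> Pl; apply: ereal_inf_lbound; exists l.
have v0 : (0 <= v)%E.
  by apply: le_ereal_inf_tmp => _ [mu [mu0 _] <-]; rewrite lee_fin ltW.
(* As v is not +oo, some mu is admissible, and - 1 / mu is an upper bound of p. *)
have p0 : (0 <= - p)%E.
  have [mu [mu0 /(v_p_setE _ mu0)]] : exists mu : R, 0 < mu /\
      exists x : 'cV[R]_n, (r (b - A *m x + mu *: u)%R <= s%:E)%E /\
      (kappa x <= mu%:E)%E.
    apply: contrapT => noT; move/eqP: vy; apply.
    apply/ereal_inf_pinfty => _ [mu [mu0 H] <-].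
    by case: noT; exists mu.
  move=> /p_lb; rewrite leeNr => /le_trans; rewrite oppe0; apply.
  by rewrite lee_fin oppr_le0 invr_ge0 ltW.
apply/le_anti/andP; split.
  apply: le_ereal_inf_tmp => _ [l Pl <-]; rewrite EFinN leeN2.
  have [l0 _] := Pl; move: l0; rewrite le_eqVlt => /predU1P[<-|l0].
    by rewrite inve_ge0.
  rewrite inve_pge ?inE ?v0 ?lee_fin ?(ltW l0)// inver gt_eqF//.
  by apply: v_lb; rewrite ?invr_gt0// invrK.
rewrite leeNr inve_ple ?inE//=.
apply: le_ereal_inf_tmp => _ [mu [mu0 /(v_p_setE _ mu0) /p_lb pl] <-].
rewrite inve_ple ?inE ?p0 ?lee_fin ?(ltW mu0)// inver gt_eqF//.
by rewrite leeNr.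
Qed.

(** Weak duality with the feasible y bounds the value below, and (w, l) = (0, 0) bounds it above by
    0. *)
Lemma p_value0 (y : 'cV[R]_m) (c : R) :
  slack 0 y -> (polar kappa (A^T *m y) <= c%:E)%E ->
  exists q : R, p_value kappa rho A b sigma 0 = q%:E.
Proof.
move=> Fy py.
have /(p_minorantP A b ckappa cr s_gt0) H := conj Fy py.
have : ((- c)%:E <= p_value kappa rho A b sigma 0)%E.
  by apply/le_p_valueP => l /H; rewrite dotv0r addr0 opprK.
have : (p_value kappa rho A b sigma 0 <= 0)%E.
  apply: ereal_inf_lbound; exists 0; rewrite ?oppr0//; split=> //; exists 0.
  by rewrite scale0r mulmx0 subrr addr0 mulr0 !gauge0 ?lee_fin.
by case: (p_value _ _ _ _ _ _) => // q _ _; exists q.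
Qed.

Lemma subdifferential_p_value (q : R) (y : 'cV[R]_m) :
  p_value kappa rho A b sigma 0 = q%:E ->
  subdifferential dotv (p_value kappa rho A b sigma) 0 y <->
  slack 0 y /\ (polar kappa (A^T *m y) <= (- q)%:E)%E.
Proof.
move=> pq; rewrite -(p_minorantP A b ckappa cr s_gt0).
rewrite /subdifferential/= pq; split=> H u.
  move=> l; have := H u; rewrite subr0 -EFinD => /le_p_valueP/[apply].
  by lra.
by rewrite subr0 -EFinD; apply/le_p_valueP => l /H; lra.
Qed.

Lemma subdifferential_v_d (V : R) (wl : 'cV[R]_n * R) : 0 < V ->
  v_d kappa rho A b sigma (0, 0) = V%:E ->
  subdifferential dotvr (v_d kappa rho A b sigma) (0, 0) wl <->
  [/\ (kappa wl.1 <= 1)%E,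
      (r (wl.2 *: b - A *m wl.1)%R <= (s * wl.2)%:E)%E & V <= wl.2].
Proof.
case: wl => w l V0 vV; rewrite -(d_minorantP A b ckappa cr s_gt0)//.
rewrite /subdifferential/= vV; split=> H z.
  by have := H z; rewrite subr0 -EFinD => /le_v_dP.
by rewrite subr0 -EFinD; apply/le_v_dP => v /H.
Qed.

End Values.

(** * Attainment, description and boundedness of the solution sets *)

Section Solutions.
Context {R : realType} {m n : nat}.
Variables (kappa : 'cV[R]_n -> \bar R) (rho : 'cV[R]_m -> \bar R).
Variables (A : 'M[R]_(m, n)) (b : 'cV[R]_m) (sigma : R).
Hypotheses (ckappa : closed_gauge kappa) (crho : closed_gauge rho).
Hypothesis sigma_ge0 : 0 <= sigma.

Local Notation r := (vf_rho rho sigma).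
Local Notation s := (vf_sigma sigma).
Local Notation hypo := (p_hypo kappa r A b s).
Local Notation slack := (dual_slack r b s).
Local Notation epi := (d_epi kappa r A b s).

Let gkappa := ckappa.1.
Let cr : closed_gauge r := vf_rho_closed_gauge sigma crho.
Let gr := cr.1.
Let s_gt0 : 0 < s := vf_sigma_gt0 sigma_ge0.

Lemma dom_gauge_le (x : 'cV[R]_n) :
  dom kappa x -> exists2 k : R, 0 < k & (kappa x <= k%:E)%E.
Proof.
rewrite /dom/=; have := gauge_ge0 gkappa x.
case: (kappa x) => // k; rewrite lee_fin => k0 _.
by exists (k + 1); rewrite ?ltr_wpDl// lee_fin lerDl.
Qed.

Lemma dom_polar_le (z : 'cV[R]_n) :
  dom (polar kappa) z -> exists2 k : R, 0 <= k & (polar kappa z <= k%:E)%E.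
Proof.
rewrite /dom/=; have := polar_ge0 kappa z.
by case: (polar kappa z) => // k; rewrite lee_fin => k0 _; exists k.
Qed.

(** A minorant of [p_value] exact at 0 is a feasible y with objective at most - q, and by weak
    duality no feasible point does better. *)
Lemma dual_attainment :
  primal_rel_strictly_feasible kappa rho A b sigma ->
  dual_feasible kappa rho A b sigma ->
  exists q : R, [/\ p_value kappa rho A b sigma 0 = q%:E,
    exists y, slack 0 y /\ (polar kappa (A^T *m y) <= (- q)%:E)%E &
    dual_solutions kappa rho A b sigma =
      [set y | slack 0 y /\ (polar kappa (A^T *m y) <= (- q)%:E)%E]].
Proof.
move=> [x0 []]; rewrite /preimage/= (primal_set_vf b sigma crho) => riF riK.
rewrite /dual_feasible (dual_set_slack b crho sigma_ge0).
move=> [_ [[y1 Fy1 <-] /dom_polar_le[c1 _ py1]]].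
have [q pq] := p_value0 ckappa crho sigma_ge0 Fy1 py1; exists q.
have [y Hy] : exists y, forall u l, hypo u l -> l + dotv y u <= - q.
  by apply: p_minorant_exists riF riK _ => //; apply/le_p_valueP; rewrite pq.
have {Hy} /= [Fy py] := (p_minorantP A b ckappa cr s_gt0 _ _).1 Hy.
split=> //; first by exists y.
rewrite /dual_solutions/argmin (dual_set_slack b crho sigma_ge0).
apply/seteqP; split=> z /=; case=> Fz pz; split=> //.
  exact: le_trans (pz _ Fy) py.
move=> w Fw; apply: le_trans pz _.
have := polar_ge0 kappa (A^T *m w).
case pw : (polar _ _) => [c||] // _; last by rewrite leey.
have H := (p_minorantP A b ckappa cr s_gt0 w c).2.
have /(le_p_valueP kappa rho A b sigma) : forall l, hypo 0 l -> l <= - - c.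
  by move=> l /H; rewrite dotv0r addr0 opprK; apply; rewrite pw.
by rewrite pq !lee_fin lerNl.
Qed.

(** Each y satisfies the minorant inequality at l = 1 / k; taking u to be plus and minus e / k along
    an axis bounds that coordinate. *)
Lemma dual_solutions_bounded (q : R) :
  primal_strictly_feasible kappa rho A b sigma ->
  bounded_set [set y | slack 0 y /\ (polar kappa (A^T *m y) <= (- q)%:E)%E].
Proof.
move=> [x0 []]; rewrite /preimage/= (primal_set_vf b sigma crho).
move=> /interior_prolong[e e0 He] /interior_subset/dom_gauge_le[k k0 kx].
have ki : 0 < k^-1 by rewrite invr_gt0.
apply: bounded_set_coord => i; exists (- q / (k^-1 * e)) => y Fy.
have {}Fy := (p_minorantP A b ckappa cr s_gt0 y (- q)).2 Fy.
have Hd d : (r (b - (A *m x0 + d))%R <= s%:E)%E ->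
    k^-1 + dotv y (- (k^-1 *: d)) <= - q.
  move=> rd; apply: Fy; split; first exact: ltW.
  exists (k^-1 *: x0); split.
    have := gauge_leZ gr (ltW ki) rd; rewrite [s * _]mulrC.
    by congr (r _ <= _)%E; rewrite -scalemxAr opprD addrA !scalerDr !scalerN.
  by have := gauge_leZ gkappa (ltW ki) kx; rewrite mulVf// gt_eqF.
have [/= /Hd H1 /Hd H2] := He i.
rewrite ler_pdivlMr ?mulr_gt0// mulrC -[k^-1 * e]gtr0_norm ?mulr_gt0// -normrM.
move: H1 H2; rewrite !dotvE !dotv_delta => H1 H2.
by rewrite ler_norml; apply/andP; split; lra.
Qed.

(** A feasible x with kappa x <= k, k > 0, yields the minorant pair (x / k, 1 / k), so 1 / k <= V.
    This gives both V > 0 and the lower bound 1 / V on [kappa]. *)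
Lemma primal_attainment :
  dual_rel_strictly_feasible kappa rho A b sigma ->
  primal_feasible kappa rho A b sigma ->
  exists V : R, [/\ 0 < V, v_d kappa rho A b sigma (0, 0) = V%:E,
    exists wl, subdifferential dotvr (v_d kappa rho A b sigma) (0, 0) wl &
    forall x, (r (b - A *m x)%R <= s%:E)%E -> (V^-1%:E <= kappa x)%E].
Proof.
rewrite /dual_rel_strictly_feasible (dual_set_slack b crho sigma_ge0).
move=> [_ [[y0 riF <-] riK]] [x1 []].
rewrite /preimage/= (primal_set_vf b sigma crho) => rx1.
move=> /dom_gauge_le[k1 k10 kx1].
have [k2 _ ky0] : exists2 k : R, 0 <= k & (polar kappa (A^T *m y0) <= k%:E)%E.
  by case: riK => /dom_polar_le.
have le_v x (k : R) : 0 < k -> (r (b - A *m x)%R <= s%:E)%E ->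
    (kappa x <= k%:E)%E -> (k^-1%:E <= v_d kappa rho A b sigma (0, 0)%R)%E.
  move=> k0 rx kx; have ki : 0 < k^-1 by rewrite invr_gt0.
  apply/le_v_dP => // v Dv.
  have H := (d_minorantP A b ckappa cr s_gt0 (k^-1 *: x) k^-1 ki).2.
  have := H _ _ _ Dv; rewrite /dotvr/= dotv0r mulr0 !addr0; apply; split=> //.
    by have := gauge_leZ gkappa (ltW ki) kx; rewrite mulVf// gt_eqF.
  have := gauge_leZ gr (ltW ki) rx; rewrite [s * _]mulrC.
  by congr (r _ <= _)%E; rewrite -scalemxAr scalerBr.
have [V vV] : exists V : R, v_d kappa rho A b sigma (0, 0) = V%:E.
  have := le_v x1 k1 k10 rx1 kx1.
  have : (v_d kappa rho A b sigma (0, 0)%R <= k2%:E)%E.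
    apply: (le_trans _ ky0); rewrite -[A^T *m y0]addr0.
    apply: ereal_inf_lbound; exists y0 => //.
    by apply/(dual_levelP b crho sigma_ge0); case: riF.
  by case: (v_d _ _ _ _ _ _) => // V _ _; exists V.
rewrite vV in le_v.
have V0 : 0 < V.
  have := le_v x1 k1 k10 rx1 kx1; rewrite lee_fin; apply: lt_le_trans.
  by rewrite invr_gt0.
exists V; split=> //.
  have [|wl Hwl] := d_minorant_exists ckappa cr riF riK (c := V).
    by apply/le_v_dP => //; rewrite vV.
  exists wl; apply/(subdifferential_v_d ckappa crho sigma_ge0 wl V0 vV).
  by move: wl Hwl => [w l] /(d_minorantP A b ckappa cr s_gt0 w l V0).
move=> x rx; have k0 := gauge_ge0 gkappa x.
case kx : (kappa x) k0 => [k||] k0; [|by rewrite leey|by []].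
(* kappa x might be 0 here, so k + e is inverted instead of k. *)
rewrite lee_fin in k0; apply/lee_addgt0Pr => e e0; rewrite -EFinD lee_fin.
have ke0 : 0 < k + e by rewrite ltr_wpDl.
have := le_v x (k + e) ke0 rx; rewrite kx !lee_fin lerDl (ltW e0) => /(_ isT).
by move=> ?; rewrite -[leRHS]invrK lef_pV2 ?posrE ?invr_gt0.
Qed.

(** A subgradient (w, l) has kappa w <= 1 and l >= V, so w / l is feasible with objective at most 1
    / V, hence optimal. Conversely, a solution x comes from the subgradient (V x, V). *)
Lemma primal_solutionsE (V : R) : 0 < V ->
  v_d kappa rho A b sigma (0, 0) = V%:E ->
  subdifferential dotvr (v_d kappa rho A b sigma) (0, 0) !=set0 ->
  (forall x, (r (b - A *m x)%R <= s%:E)%E -> (V^-1%:E <= kappa x)%E) ->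
  primal_solutions kappa rho A b sigma =
    [set x | (r (b - A *m x)%R <= s%:E)%E /\ (kappa x <= V^-1%:E)%E] /\
  primal_solutions kappa rho A b sigma =
    [set wl.2^-1 *: wl.1 | wl in
      subdifferential dotvr (v_d kappa rho A b sigma) (0, 0)
      `&` [set wl | 0 < wl.2]].
Proof.
move=> V0 vV [wl0 Dwl0] V_le.
have subP wl := subdifferential_v_d ckappa crho sigma_ge0 wl V0 vV.
have feas wl : subdifferential dotvr (v_d kappa rho A b sigma) (0, 0) wl ->
    (r (b - A *m (wl.2^-1 *: wl.1))%R <= s%:E)%E /\
    (kappa (wl.2^-1 *: wl.1)%R <= V^-1%:E)%E.
  move=> /subP[kw rw Vl]; have l0 : 0 < wl.2 by exact: lt_le_trans Vl.
  have li : 0 < wl.2^-1 by rewrite invr_gt0.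
  split.
    have := gauge_leZ gr (ltW li) rw.
    rewrite mulrCA mulVf ?gt_eqF// mulr1.
    congr (r _ <= _)%E.
    by rewrite scalerBr scalerA mulVf ?gt_eqF// scale1r -scalemxAr.
  apply: le_trans (gauge_leZ gkappa (ltW li) kw) _.
  by rewrite mulr1 lee_fin lef_pV2.
have solE : primal_solutions kappa rho A b sigma =
    [set x | (r (b - A *m x)%R <= s%:E)%E /\ (kappa x <= V^-1%:E)%E].
  apply/seteqP; split=> x /=.
    move=> [/(primal_setE sigma crho) rx xmin]; split=> //.
    have [r0 k0] := feas _ Dwl0; apply: le_trans k0; apply: xmin.
    exact/(primal_setE sigma crho).
  move=> [rx kx]; split; first exact/(primal_setE sigma crho).
  move=> z /(primal_setE sigma crho) /V_le; exact: le_trans.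
split=> //; rewrite solE; apply/seteqP; split=> x /=.
  move=> [rx kx]; exists (V *: x, V); last first.
    by rewrite /= scalerA mulVf ?scale1r// gt_eqF.
  split=> //; apply/subP; split=> //=.
    by have := gauge_leZ gkappa (ltW V0) kx; rewrite mulfV// gt_eqF.
  have := gauge_leZ gr (ltW V0) rx; rewrite [s * _]mulrC.
  by congr (r _ <= _)%E; rewrite -scalemxAr scalerBr.
by move=> [wl [/feas wlP _] <-].
Qed.

(** Feasibility of x and y0 gives [dotv x (A^T *m y0)] >= 1, while the finite polars at A^T y0 plus
    and minus e along an axis bound the perturbed products above, hence the coordinate. *)
Lemma primal_solutions_bounded (c : R) :
  dual_strictly_feasible kappa rho A b sigma ->
  bounded_set [set x | (r (b - A *m x)%R <= s%:E)%E /\ (kappa x <= c%:E)%E].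
Proof.
rewrite /dual_strictly_feasible (dual_set_slack b crho sigma_ge0).
move=> [_ [[y0 /interior_subset [a [pa ay]] <-] /interior_prolong[e e0 He]]].
apply: bounded_set_coord => i.
have [/dom_polar_le[k k0 pk] /dom_polar_le[h h0 ph]] := He i.
exists ((k + h) * c / e) => x [rx kx].
have c0 := gauge_le_ge0 gkappa kx.
have := polar_le_dotv gkappa ph kx; have := polar_le_dotv gkappa pk kx.
have := polar_le_dotv gr pa rx.
rewrite !dotvE -dotv_mulmx !dotv_delta => H1 H2 H3.
rewrite ler_pdivlMr// mulrC -[X in X * _]gtr0_norm// -normrM.
have := mulr_ge0 k0 c0; have := mulr_ge0 h0 c0.
by rewrite ler_norml => ? ?; apply/andP; split; lra.
Qed.

End Solutions.

Theorem theorem3p5 (R : realType) (m n : nat)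
    (kappa : 'cV[R]_n -> \bar R) (rho : 'cV[R]_m -> \bar R)
    (A : 'M[R]_(m, n)) (b : 'cV[R]_m) (sigma : R)
    (kappa_gauge : closed_gauge kappa) (rho_gauge : closed_gauge rho)
    (sigma_ge0 : 0 <= sigma) (sigma_lt : (sigma%:E < rho b)%E) :
  (primal_rel_strictly_feasible kappa rho A b sigma ->
   dual_feasible kappa rho A b sigma ->
   [/\ dual_solutions kappa rho A b sigma !=set0,
       dual_solutions kappa rho A b sigma
         = subdifferential dotv (p_value kappa rho A b sigma) 0,
       dual_solutions kappa rho A b sigma
         = subdifferential dotv (neg_inv_v_p kappa rho A b sigma) 0
     & primal_strictly_feasible kappa rho A b sigma ->
       bounded_set (dual_solutions kappa rho A b sigma)])
  /\
  (dual_rel_strictly_feasible kappa rho A b sigma ->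
   primal_feasible kappa rho A b sigma ->
   [/\ primal_solutions kappa rho A b sigma !=set0,
       primal_solutions kappa rho A b sigma
         = [set wl.2^-1 *: wl.1 | wl in
             subdifferential dotvr (v_d kappa rho A b sigma) (0, 0)
             `&` [set wl | 0 < wl.2]]
     & dual_strictly_feasible kappa rho A b sigma ->
       bounded_set (primal_solutions kappa rho A b sigma)]).
Proof.
split=> strict feas.
  have [q [pq [y Fy] ->]] :=
    dual_attainment kappa_gauge rho_gauge sigma_ge0 strict feas.
  have subE : [set y | dual_slack (vf_rho rho sigma) b (vf_sigma sigma) 0 y /\
      (polar kappa (A^T *m y) <= (- q)%:E)%E] =
      subdifferential dotv (p_value kappa rho A b sigma) 0.
    by apply/seteqP; split=> z;
      move/(subdifferential_p_value kappa_gauge rho_gauge sigma_ge0 z pq).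
  split=> //; first by exists y.
    by rewrite neg_inv_v_pE.
  exact: dual_solutions_bounded.
have [V [V0 vV [wl Dwl] V_le]] :=
  primal_attainment kappa_gauge rho_gauge sigma_ge0 strict feas.
have Dn0 : subdifferential dotvr (v_d kappa rho A b sigma) (0, 0) !=set0.
  by exists wl.
have [solE subE] :=
  primal_solutionsE kappa_gauge rho_gauge sigma_ge0 V0 vV Dn0 V_le.
split=> //; last by rewrite solE; exact: primal_solutions_bounded.
rewrite subE; exists (wl.2^-1 *: wl.1), wl => //; split=> //=.
(* The second component of a subgradient is at least V > 0. *)
have [_ _] :=
  (subdifferential_v_d kappa_gauge rho_gauge sigma_ge0 wl V0 vV).1 Dwl.
exact: lt_le_trans.
Qed.
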